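(* Let $k\in\mathbb{Z}$, $n,j\in\mathbb{Z}^+$, and let $G=(V,E)$ be a $j$-regular simple graph. If $\gcd(j+1,n)\mid k$, then $\chi_{n,k}(G)=\chi(G)$. If $G$ is finite and $\gcd(j+1,n)\nmid k|V|$, then $\chi_{n,k}(G)$ does not exist.
   Context: Graphs may be infinite. A labeling $\ell:V\to\mathbb{Z}$ is proper if adjacent vertices get distinct labels; its order is the size of its image; $\chi(G)$ is the minimum order of a proper labeling. It is a closed coloring with remainder $k\bmod n$ if $\sum_{w\in N[v]}\ell(w)\equiv k\pmod n$ for every $v$, where $N[v]$ is the closed neighborhood of $v$. $\chi_{n,k}(G)$ exists iff a proper closed coloring with remainder $k\bmod n$ exists, and then is the minimum order of such a coloring ($\infty$ if only infinite-order ones exist). *)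

(* Defs.v *)
From HB Require Import structures.
From mathcomp Require Import all_boot all_order all_algebra finmap.
From mathcomp Require Import all_classical.
From mathcomp Require Import constructive_ereal.

Set Implicit Arguments.
Unset Strict Implicit.
Unset Printing Implicit Defensive.

Local Open Scope classical_set_scope.
Local Open Scope card_scope.
Local Open Scope ring_scope.

(* The vertex type may be infinite, of any cardinality. *)
Record sgraph := SGraph {
  vertex :> choiceType;
  adj : vertex -> vertex -> Prop;
  adj_sym : forall u v, adj u v -> adj v u;
  adj_irr : forall v, ~ adj v v }.

Definition open_nbhd (G : sgraph) (v : G) : set G := [set w | adj v w].

Definition closed_nbhd (G : sgraph) (v : G) : set G := v |` open_nbhd v.

Definition regular (G : sgraph) (j : nat) : Prop :=
  forall v : G, open_nbhd v #= `I_j.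

Definition proper_labeling (G : sgraph) (l : G -> int) : Prop :=
  forall u v : G, adj u v -> l u <> l v.

(* The sum is the one over the finite set N[v] when G is locally finite (in
   particular when G is regular); over an infinite N[v] with infinitely many
   nonzero labels, the operator has the junk value 0. *)
Definition closed_coloring (n : nat) (k : int) (G : sgraph) (l : G -> int) :
    Prop :=
  forall v : G,
    ((\sum_(w \in closed_nbhd v) l w)%R = k %[mod n%:Z])%Z.

Definition labeling_order (G : sgraph) (l : G -> int) : \bar int :=
  if `[< finite_set (range l) >] then (#|` fset_set (range l)|%fset)%:Z%:E%E
  else +oo%E.

(* Orders are natural numbers or +oo, so a nonempty P has a minimum order;
   the default value +oo of xget is used only when P is empty. *)
Definition min_order (G : sgraph) (P : set (G -> int)) : \bar int :=
  xget +oo%E [set c | (@labeling_order G @` P) c /\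
                      lbound (@labeling_order G @` P) c].

Definition chi (G : sgraph) : \bar int := min_order (@proper_labeling G).

Definition proper_closed_coloring (n : nat) (k : int) (G : sgraph) :
    set (G -> int) :=
  [set l | proper_labeling l /\ closed_coloring n k l].

Definition chi_nk_exists (n : nat) (k : int) (G : sgraph) : Prop :=
  exists l : G -> int, proper_closed_coloring n k l.

(* Meaningful only under [chi_nk_exists n k G]. *)
Definition chi_nk (n : nat) (k : int) (G : sgraph) : \bar int :=
  min_order (@proper_closed_coloring n k G).

(* Main.v *)
Require Import Defs.
From HB Require Import structures.
From mathcomp Require Import all_boot all_order all_algebra finmap.
From mathcomp Require Import all_classical.
From mathcomp Require Import constructive_ereal.

(**
  If [l] is a proper labeling, so is [a + n * l] for every [a], and it has the
  same order; it is a closed coloring with remainder [(j + 1) * a] mod [n],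
  which is [k] for a suitable [a] by Bezout. Conversely, summing the [|V|]
  congruences of a closed coloring counts each label [j + 1] times, so
  [k * |V|] is [j + 1] times the total label, modulo [n].
*)

Set Implicit Arguments.
Unset Strict Implicit.
Unset Printing Implicit Defensive.

Import GRing.Theory.

Local Open Scope classical_set_scope.
Local Open Scope card_scope.
Local Open Scope ring_scope.

Lemma fsumr_const (V : zmodType) (T : choiceType) (A : set T) (m : nat) (c : V) :
  A #= `I_m -> \sum_(x \in A) c = c *+ m.
Proof.
move=> Am; have fA : finite_set A by apply/finite_setP; exists m.
by rewrite fsbig_finite// big_const_seq count_predT (card_fset_set Am) iter_addr_0.
Qed.

Lemma infinite_int : infinite_set [set: int].
Proof.
apply: contra_not infinite_nat => fZ.
have fP : finite_set [set Posz m | m in setT] by apply: sub_finite_set fZ.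
by rewrite (eq_finite_set (inj_card_eq _)) in fP => // x y _ _ [].
Qed.

(* Zorn on the graphs of partial proper labelings: a vertex left unlabeled by a
   maximal one could receive any integer missing from its finitely many
   neighbors. *)
Lemma locally_finite_proper_labeling (G : sgraph) :
  (forall v : G, finite_set (open_nbhd v)) ->
  exists l : G -> int, proper_labeling l.
Proof.
move=> finG.
(* The first clause makes [S] the graph of a partial function, the second makes that function
   proper. *)
pose compat (x y : G * int) :=
  (x.1 = y.1 -> x.2 = y.2) /\ (adj x.1 y.1 -> x.2 <> y.2).
pose P (S : set (G * int)) := forall x y, S x -> S y -> compat x y.
have [|S [PS maxS]] := @Zorn_bigcup _ P.
  (* Two points of the union of a chain lie in a common member, so a condition on pairs passes to
     the union. *)
  move=> F FP Ftot x y [X FX Xx] [Y FY Yy].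
  case: (Ftot X Y FX FY) => [XY|YX].
    by apply: (FP Y) => //; exact: XY.
  by apply: (FP X) => //; exact: YX.
have Stot v : exists a, S (v, a).
  apply: contrapT => Nv.
  (* An unlabeled neighbor contributes the default [0], which at worst excludes one more integer and
     keeps [used] finite. *)
  pose used := [set xget 0 [set a | S (w, a)] | w in open_nbhd v].
  have [z [_ Uz]] : ([set: int] `\` used) !=set0.
    apply: infinite_setN0; apply: infinite_setD; first exact: infinite_int.
    exact: finite_image.
  have zfree w : adj v w -> ~ S (w, z).
    move=> vw Swz; apply: Uz; exists w => //.
    case: xgetP => [a _ Swa|/(_ z)//].
    by have [/= -> ] := PS _ _ Swa Swz.
  apply: (maxS ((v, z) |` S)).
    split; first by move=> x Sx; right.
    by move=> /(_ (v, z)) Svz; apply: Nv; exists z; apply: Svz; left.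
  move=> [x a] [y b] [[-> ->]|Sx] [[-> ->]|Sy].
  - by split=> // /adj_irr.
  - split=> /= [vy|vy zb]; first by case: Nv; exists b; rewrite vy.
    by apply: (zfree _ vy); rewrite zb.
  - split=> /= [xv|xv az]; first by case: Nv; exists a; rewrite -xv.
    by apply: (zfree _ (adj_sym xv)); rewrite -az.
  - exact: PS.
have [l Sl] := choice Stot.
by exists l => u v uv; exact: (PS _ _ (Sl u) (Sl v)).2.
Qed.

Section RegularGraph.
Variables (G : sgraph) (j : nat).
Hypothesis Greg : regular G j.

Lemma finite_open_nbhd (v : G) : finite_set (open_nbhd v).
Proof. by apply/finite_setP; exists j; exact: Greg. Qed.

Lemma finite_closed_nbhd (v : G) : finite_set (closed_nbhd v).
Proof. by rewrite /closed_nbhd finite_setU; split=> //; exact: finite_open_nbhd. Qed.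

(** No vertex is its own neighbor, so the union is disjoint and has [1 + j] elements. *)
Lemma fsum_closed_nbhd_const (v : G) (c : int) :
  \sum_(w \in closed_nbhd v) c = c *+ j.+1.
Proof.
rewrite /closed_nbhd fsbigU0 //; last 2 first.
- exact: finite_open_nbhd.
- by move=> w [/= -> /adj_irr].
by rewrite fsbig_set1 (fsumr_const _ (Greg v)) mulrS.
Qed.

Lemma fsum_closed_nbhd_affine (a m : int) (l : G -> int) (v : G) :
  \sum_(w \in closed_nbhd v) (a + m * l w) =
  a *+ j.+1 + m * \sum_(w \in closed_nbhd v) l w.
Proof.
rewrite fsbig_split /=; last exact: finite_closed_nbhd.
by rewrite fsum_closed_nbhd_const mulr_fsumr.
Qed.

Lemma closed_nbhd_sym (v w : G) : closed_nbhd v w -> closed_nbhd w v.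
Proof. by case=> [->|/adj_sym]; [left|right]. Qed.

(** Double counting: [w] lies in the closed neighborhood of [v] iff [v] lies in that of [w], so
    [l w] occurs once for each of the [j + 1] elements of the latter. *)
Lemma sum_fsum_closed_nbhd (l : G -> int) : finite_set [set: G] ->
  \sum_(v \in [set: G]) \sum_(w \in closed_nbhd v) l w =
  (\sum_(v \in [set: G]) l v) *+ j.+1.
Proof.
move=> finG; under eq_fsbigr do rewrite fsbig_mkcond.
rewrite exchange_fsbig // -mulr_natr mulr_fsuml; apply: eq_fsbigr => w _.
rewrite mulr_natr -(fsum_closed_nbhd_const w) [RHS]fsbig_mkcond.
apply: eq_fsbigr => v _; rewrite /patch.
by congr (if _ then _ else _); apply/asboolP/asboolP; exact: closed_nbhd_sym.
Qed.

End RegularGraph.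

Lemma labeling_order_inj (G : sgraph) (l : G -> int) (f : int -> int) :
  injective f -> labeling_order (f \o l) = labeling_order l.
Proof.
move=> f_inj; rewrite /labeling_order.
have -> : range (f \o l) = f @` range l.
  by rewrite image_comp.
have eqr : f @` range l #= range l by apply: inj_card_eq => x y _ _ /f_inj.
have -> : finite_set (f @` range l) = finite_set (range l).
  by apply/propext; rewrite (eq_finite_set eqr).
case: asboolP => // fl; congr (_%:Z%:E)%E.
by rewrite fset_set_image // card_imfset.
Qed.

Lemma mul_mod_solvable (m n : nat) (k : int) : ((gcdn m n)%:Z %| k)%Z ->
  exists a : int, (a *+ m = k %[mod n%:Z])%Z.
Proof.
move=> /dvdzP[q ->]; have [u [v uv]] := Bezoutz m n.
(* As [u * m + v * n] is the gcd, [q * u * m] differs from [k] by the multiple [q * v * n] of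
   [n]. *)
exists (q * u); rewrite -mulr_natr.
have -> : (gcdn m n)%:Z = gcdz m n by [].
rewrite -uv mulrDr !mulrA [in RHS]addrC modzMDl.
by rewrite natz.
Qed.

Lemma fsum_eqmodz (T : choiceType) (A : set T) (F : T -> int) (m : nat) (k d : int) :
  A #= `I_m -> (forall x, (F x = k %[mod d])%Z) ->
  (\sum_(x \in A) F x = k * m%:Z %[mod d])%Z.
Proof.
move=> Am Fk.
have -> : k * m%:Z = \sum_(x \in A) k by rewrite (fsumr_const _ Am) -mulr_natr natz.
have fA : finite_set A by apply/finite_setP; exists m.
rewrite !fsbig_finite //; elim: (finmap.enum_fset _) => [|x s IHs].
  by rewrite !big_nil.
by rewrite !big_cons -modzDm Fk IHs modzDm.
Qed.

Theorem theorem4p4 (k : int) (n j : nat) (G : sgraph)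
    (n_gt0 : (0 < n)%N) (j_gt0 : (0 < j)%N) (Greg : regular G j) :
  (((gcdn j.+1 n)%:Z %| k)%Z ->
     chi_nk_exists n k G /\ chi_nk n k G = chi G) /\
  (forall N : nat, [set: G] #= `I_N ->
     ~~ ((gcdn j.+1 n)%:Z %| k * N%:Z)%Z -> ~ chi_nk_exists n k G).
Proof.
split=> [/mul_mod_solvable[a ak]|N GN /negP Ndvd [l [_ cl]]].
  pose f (x : int) : int := a + n%:Z * x.
  have f_inj : injective f.
    move=> x y /addrI /mulfI; apply.
    by move: n_gt0; rewrite lt0n.
  have closed_f (l : G -> int) :
    proper_labeling l -> proper_closed_coloring n k (f \o l).
    move=> pl; split=> [u v /pl luv /f_inj //|v].
    by rewrite /= (fsum_closed_nbhd_affine Greg) addrC mulrC modzMDl.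
  split.
    (* Existence is a real issue only for infinite [G]; regularity gives the finite neighborhoods
       needed. *)
    have [l pl] := @locally_finite_proper_labeling G (finite_open_nbhd Greg).
    by exists (f \o l); exact: closed_f.
  (* Both minima range over the same set of orders: closed colorings are already proper, and [f]
     turns any proper labeling into a closed coloring of equal order. *)
  rewrite /chi_nk /chi /min_order; set A := _ @` _; set B := _ @` _.
  suff -> : A = B by [].
  apply/seteqP; split=> _ [l pl <-].
    by exists l => //; case: pl.
  by exists (f \o l); [exact: closed_f|exact: labeling_order_inj].
apply: Ndvd.
have finG : finite_set [set: G] by apply/finite_setP; exists N.
have := fsum_eqmodz GN cl; rewrite (sum_fsum_closed_nbhd Greg) // => /eqP.
rewrite eqz_mod_dvd => dvdn_diff; set s := \sum_(v \in _) l v in dvdn_diff.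
(* The gcd divides [n], hence this difference, and it divides [j.+1], hence the first term; so it
   divides [k * N]. *)
have gn : ((gcdn j.+1 n)%:Z %| s *+ j.+1 - k * N%:Z)%Z.
  by apply: dvdz_trans dvdn_diff; exact: dvdn_gcdr.
have gj : ((gcdn j.+1 n)%:Z %| s *+ j.+1)%Z.
  by rewrite -mulr_natr natz dvdz_mull //; exact: dvdn_gcdl.
by rewrite -(subKr (s *+ j.+1) (k * N%:Z)) rpredB.
Qed.
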